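(* Let $X$ be a locally convex Hausdorff topological vector space, let $g,h:X\to\overline{\mathbb R}$ be proper generalized polyhedral convex functions, and let $C\subset X$ be a nonempty generalized polyhedral convex set. Consider the problem of minimizing $f(x):=g(x)-h(x)$ over $x\in C$. If $C\subset\mathrm{dom}\,g$ and $C\subset\mathrm{int}(\mathrm{dom}\,h)$, then the local solution set $\mathcal S_{1a}$ of this problem is the union of finitely many semi-closed generalized polyhedral convex subsets of $C$, while the global solution set $\mathcal S$ of the problem is the union of finitely many generalized polyhedral convex sets.
   Context: $\overline{\mathbb R}=\mathbb R\cup\{\pm\infty\}$. $\mathrm{dom}\,\varphi=\{x\mid\varphi(x)<+\infty\}$, $\mathrm{epi}\,\varphi=\{(x,\alpha)\in X\times\mathbb R\mid x\in\mathrm{dom}\,\varphi,\ \varphi(x)\le\alpha\}$; $\varphi$ is proper if $\mathrm{dom}\,\varphi\ne\emptyset$ and $\varphi>-\infty$ everywhere; $\mathrm{int}$ denotes interior. A subset of a locally convex Hausdorff topological vector space $Z$ is generalized polyhedral convex if it has the form $\{z\in L\mid\langle z_k^*,z\rangle\le\alpha_k,\ k=1,\dots,p\}$ with $L\subset Z$ a closed affine subspace, $z_k^*\in Z^*$ (the topological dual), $\alpha_k\in\mathbb R$. A function $\varphi:X\to\overline{\mathbb R}$ is generalized polyhedral convex if $\mathrm{epi}\,\varphi$ is a generalized polyhedral convex set in $X\times\mathbb R$. A semi-closed generalized polyhedral convex subset of $C$ is a set of the form $P\cap O$, where $P\subset C$ is a generalized polyhedral convex set and $O\subset C$ is a convex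 set which is open in the relative topology of $C$. $\mathcal S$ is the set of $\bar x\in C$ with $f(\bar x)\le f(x)$ for all $x\in C$; $\mathcal S_{1a}$ is the set of $\bar x\in C$ for which there is a neighborhood $U$ of $\bar x$ with $f(\bar x)\le f(x)$ for all $x\in C\cap U$. *)

(* Defs.v *)
From HB Require Import structures.
From mathcomp Require Import all_boot all_order all_algebra.
From mathcomp Require Import all_classical all_reals all_analysis.

Set Implicit Arguments.
Unset Strict Implicit.
Unset Printing Implicit Defensive.

Import Order.TTheory GRing.Theory Num.Theory.
Import numFieldTopology.Exports numFieldNormedType.Exports.

Local Open Scope classical_set_scope.
Local Open Scope ring_scope.

Definition affine_set (R : realType) (Z : lmodType R) (L : set Z) : Prop :=
  forall (x y : Z) (t : R), L x -> L y -> L ((1 - t) *: x + t *: y).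

(* [R^o] is [R] seen as a topological vector space over itself, so the
   functionals [zs k] below are the elements of the topological dual of [Z].
   Allowing [L = set0] or [p = 0] does not change the class: the empty set is
   also cut out by [0 <= -1], and [0 <= 0] is a vacuous constraint. *)
Definition gen_polyhedral_convex_set (R : realType) (Z : tvsType R)
    (D : set Z) : Prop :=
  exists (L : set Z) (p : nat) (zs : 'I_p -> {linear Z -> R^o})
         (alpha : 'I_p -> R),
    [/\ affine_set L,
        closed L,
        forall k, continuous (zs k)
      & D = [set z | L z /\ forall k, zs k z <= alpha k] ].

Section ExtendedRealFunctions.
Context {R : realType} {X : tvsType R}.
Implicit Type phi : X -> \bar R.

Definition dom phi : set X := [set x | (phi x < +oo)%E].

Definition epi phi : set (X * R^o) :=
  [set xa | dom phi xa.1 /\ (phi xa.1 <= xa.2%:E)%E].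

Definition proper_fun phi : Prop :=
  dom phi !=set0 /\ forall x, (-oo < phi x)%E.

Definition gen_polyhedral_convex_fun phi : Prop :=
  gen_polyhedral_convex_set (epi phi).

End ExtendedRealFunctions.

Definition semiclosed_gen_polyhedral_convex_subset (R : realType)
    (X : tvsType R) (C D : set X) : Prop :=
  exists (P O : set X),
    [/\ gen_polyhedral_convex_set P,
        P `<=` C,
        O `<=` C /\ convex_set O,
        open (O : set (subspace C))
      & D = P `&` O].

Definition finite_union_of (T : Type) (Q : set T -> Prop) (S : set T) : Prop :=
  exists (n : nat) (D : 'I_n -> set T),
    (forall i, Q (D i)) /\ S = \bigcup_i D i.

Definition global_solutions (R : realType) (X : tvsType R)
    (f : X -> \bar R) (C : set X) : set X :=
  [set xb | C xb /\ forall x, C x -> (f xb <= f x)%E].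

Definition local_solutions (R : realType) (X : tvsType R)
    (f : X -> \bar R) (C : set X) : set X :=
  [set xb | C xb /\ exists2 U : set X, nbhs xb U &
     forall x, (C `&` U) x -> (f xb <= f x)%E].

(* Main.v *)
Require Import Defs.
From HB Require Import structures.
From mathcomp Require Import all_boot all_order all_algebra.
From mathcomp Require Import all_classical all_reals all_analysis.
From mathcomp Require Import ring lra.

Import Order.TTheory GRing.Theory Num.Theory.
Import numFieldTopology.Exports numFieldNormedType.Exports.

Local Open Scope classical_set_scope.
Local Open Scope ring_scope.

(** A generalized polyhedral convex function is, on its domain, the maximum of
    finitely many continuous affine functions: the epigraph lives in a closed
    affine subspace containing every vertical line over the domain, and each
    linear constraint on (x, s) that involves s at all solves to a lower bound
    on s that is affine in x ([gpc_fun_max]). So on [C] the objective is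
    [f = max_i a_i - max_j b_j], and both assertions are about such functions.

    Global solutions ([global_solutions_diff_max]).  If [f] attains a minimum
    [m] over [C], the solutions are the [x] in [C] with [f x <= m].  That reads
    [max_i a_i x <= m + max_j b_j x], that is, for some [j], [a_i x - b_j x <= m]
    for all [i].  Each [j] thus gives a generalized polyhedral convex piece.
    If there is no minimum, the union is empty.

    Local solutions ([local_solutions_diff_max]).  Write [g = max_i a_i] and
    [h = max_j b_j], and call [j] active at [x] when [b_j x = h x].  Since
    [f <= g - b_j], with equality at [x] for an active [j], a local minimizer
    [x] of [f] is a local, hence by convexity a global, minimizer of [g - b_j]
    over [C] for every active [j].  Conversely, only the indices active at [x]
    can be active near [x], so a point that minimizes [g - b_j] for every active
    [j] is a local minimizer of [f].  The minimizers of the maximum of affine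
    functions [g - b_j] form a generalized polyhedral convex set, and it
    remains to sort the points by active index set.  The set where all active
    indices lie in [K] is relatively open but in general not convex; it is covered by the
    convex sets where every [b_j] with [j] outside [K] is below one chosen
    [b_j0].  Hence one piece for each pair [(K, j0)]. *)

(** * Maxima of finite families and finite unions *)

(** A relation between [a] and [G], so that an empty family calls for no default
    value. *)
Definition is_max_on {T : Type} {R : realType} {I : Type} (a : I -> T -> R)
    (G : T -> R) (D : set T) : Prop :=
  forall x, D x -> (forall i, a i x <= G x) /\ exists i, a i x = G x.

Lemma is_max_onB {T : Type} {R : realType} {I : Type} {a : I -> T -> R}
    {G : T -> R} (b : T -> R) {D : set T} :
  is_max_on a G D -> is_max_on (fun i x => a i x - b x) (fun x => G x - b x) D.
Proof.
move=> aG x /aG [aleG [i aiG]]; split; last by exists i; rewrite aiG.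
by move=> j; rewrite lerD2r.
Qed.

Lemma is_max_onS {T : Type} {R : realType} {I : Type} {a : I -> T -> R}
    {G : T -> R} {D E : set T} :
  E `<=` D -> is_max_on a G D -> is_max_on a G E.
Proof. by move=> ED aG x /ED/aG. Qed.

Lemma finite_union_of_fintype {T : Type} {Q : set T -> Prop} {I : finType}
    {D : I -> set T} :
  (forall i, Q (D i)) -> finite_union_of Q (\bigcup_i D i).
Proof.
move=> QD; exists #|I|, (fun k => D (enum_val k)); split=> //.
apply/seteqP; split=> x [i _ Dx]; last by exists (enum_val i).
by exists (enum_rank i) => //=; rewrite enum_rankK.
Qed.

(** * Continuous affine functions and generalized polyhedral convex sets *)

(** Affine functions rather than linear ones plus a constant: no linear part has
    to be carried along in the constructions below. *)
Definition cont_affine {R : realType} {X : tvsType R} (a : X -> R^o) : Prop :=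
  continuous a /\
  forall x y t, a ((1 - t) *: x + t *: y) = (1 - t) * a x + t * a y.

Section GenPolyhedralConvexSets.
Context {R : realType} {X : tvsType R}.
Implicit Types (a b : X -> R^o) (C D : set X).

Lemma cont_affine_cst (c : R) : cont_affine ((fun=> c) : X -> R^o).
Proof. by split=> [x|x y t]; [exact: cvg_cst|ring]. Qed.

Lemma cont_affineB a b :
  cont_affine a -> cont_affine b -> cont_affine (fun x => a x - b x).
Proof.
move=> [ca aa] [cb ab]; split; last by move=> x y t; rewrite aa ab; ring.
by move=> x; apply: (@cvgB _ _ X); [exact: ca|exact: cb].
Qed.

Lemma gpc_setT : gen_polyhedral_convex_set [set: X].
Proof.
exists [set: X], 0%N, (fun=> \0), (fun=> 0); split => //.
- by move=> k; case: k.
- by apply/seteqP; split => // x _; split => // -[].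
Qed.

Lemma gpc_setI C D : gen_polyhedral_convex_set C ->
  gen_polyhedral_convex_set D -> gen_polyhedral_convex_set (C `&` D).
Proof.
move=> [L [p [z [al [affL cL cz ->]]]]] [M [q [w [be [affM cM cw ->]]]]].
exists (L `&` M), (p + q)%N,
  (fun k => match fintype.split k with inl i => z i | inr j => w j end),
  (fun k => match fintype.split k with inl i => al i | inr j => be j end); split.
- by move=> x y t [Lx Mx] [Ly My]; split; [exact: affL|exact: affM].
- exact: closedI.
- by move=> k; case: (fintype.split k).
- apply/seteqP; split=> [x [[Lx zx] [Mx wx]]|x [[Lx Mx] zw]].
    by split=> // k; case: (fintype.split k).
  split; split=> // k.
    by have := zw (lshift q k); rewrite (unsplitK (inl k)).
  by have := zw (rshift p k); rewrite (unsplitK (inr k)).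
Qed.

Lemma gpc_bigcap {I : finType} {D : I -> set X} :
  (forall i, gen_polyhedral_convex_set (D i)) ->
  gen_polyhedral_convex_set (\bigcap_i D i).
Proof.
move=> gD; have -> : [set: I] = [set` enum I].
  by apply/seteqP; split=> // i _ /=; rewrite mem_enum.
rewrite bigcap_seq; elim/big_ind: _ => //; [exact: gpc_setT|exact: gpc_setI].
Qed.

(** The linear functional demanded by the definition is [x |-> a x - a 0]; its
    additivity comes from [a] at the midpoint of [2 x] and [2 y]. *)
Lemma gpc_sublevel a (c : R) :
  cont_affine a -> gen_polyhedral_convex_set [set x | a x <= c].
Proof.
move=> [ca aa].
pose v (x : X) : R^o := a x - a 0.
have vZ t x : v (t *: x) = t * v x.
  by have := aa 0 x t; rewrite scaler0 add0r /v => ->; ring.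
have vD x y : v (x + y) = v x + v y.
  have half2 : (2^-1 + 2^-1 : R) = 1 by lra.
  have := aa (2 *: x) (2 *: y) 2^-1.
  have -> : 1 - 2^-1 = 2^-1 :> R by lra.
  rewrite !scalerA mulVf ?pnatr_eq0// !scale1r {1}/v => ->.
  have := vZ 2 x; have := vZ 2 y; rewrite /v; lra.
have vlin : GRing.linear_for *:%R v by move=> t x y; rewrite vD vZ.
pose vL := GRing.isLinear.Build R X R^o *:%R v vlin.
pose V : {linear X -> R^o} := HB.pack v vL.
exists [set: X], 1%N, (fun=> V), (fun=> c - a 0); split => //.
- by move=> _ x; apply: (@cvgB _ _ X); [exact: ca|exact: cvg_cst].
- apply/seteqP; split=> x /=; rewrite /v => ax; first by split=> // _; rewrite lerD2r.
  by case: ax => _ /(_ ord0); rewrite lerD2r.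
Qed.

Lemma gpc_set0 : gen_polyhedral_convex_set (set0 : set X).
Proof.
have -> : set0 = [set _ : X | 0 <= (-1 : R)].
  by apply/seteqP; split=> x //=; rewrite ler0N1.
exact/gpc_sublevel/cont_affine_cst.
Qed.

Lemma gpc_segment C x y (t : R) : gen_polyhedral_convex_set C ->
  C x -> C y -> 0 <= t <= 1 -> C ((1 - t) *: x + t *: y).
Proof.
move=> [L [p [z [al [affL _ _ ->]]]]] [Lx zx] [Ly zy] /andP[t0 t1].
split=> [|k]; first exact: affL.
rewrite linearD !linearZ /= /GRing.scale/=.
have := zx k; have := zy k; nra.
Qed.

(** Continuity of the vector space operations makes [(1 - t) x + t y] tend to
    [x] as [t] tends to [0]; taken from the right, this gives a positive [t]. *)
Lemma near_segment x y (U : set X) : nbhs x U ->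
  exists2 t : R, 0 < t <= 1 & U ((1 - t) *: x + t *: y).
Proof.
move=> xU.
have cvg_t : (1 - t) *: x + t *: y @[t --> (0 : R^o)] --> x.
  have lin (s : R^o -> R^o) (z : X) : s t @[t --> (0 : R^o)] --> s 0 ->
      s t *: z @[t --> (0 : R^o)] --> s 0 *: z.
    move=> cs; apply: (@continuous2_cvg _ _ _ _ _ _ s (fun=> z) ( *:%R) (s 0) z
      (@scale_continuous R X (s 0, z)) cs).
    by apply: cvg_cst.
  have -> : nbhs x = nbhs ((1 - 0) *: x + (0 : R^o) *: y).
    by rewrite subr0 scale1r scale0r addr0.
  apply: (@continuous2_cvg _ _ _ _ _ _ _ _ +%R _ _ (@add_continuous X (_, _))).
    apply: (lin (fun t => 1 - t)).
    by apply: (@cvgB _ _ R^o); [exact: cvg_cst|exact: cvg_id].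
  by apply: (lin id); exact: cvg_id.
have : \forall t \near (0 : R)^'+,
    [/\ 0 < t, t <= 1 & U ((1 - t) *: x + t *: y)].
  near=> t; split; near: t; [exact: nbhs_right_gt|exact: nbhs_right_ltW|].
  exact: (cvg_at_right_filter cvg_t).
by case/filter_ex => t [t0 t1 Ut]; exists t => //; rewrite t0.
Unshelve. all: by end_near. Qed.

Lemma open_cont_affine_lt {J : finType} (K : {set J}) (b : J -> X -> R^o)
    (j0 : J) : (forall j, cont_affine (b j)) ->
  open [set x | forall j, j \notin K -> b j x < b j0 x].
Proof.
move=> cb; rewrite openE => x /= bx.
have : \forall y \near x, forall j, j \notin K -> b j y < b j0 y.
  apply: filter_forall => j; case: (boolP (j \in K)) => jK.
    by apply: nearW.
  have [c _] := cont_affineB _ _ (cb j) (cb j0).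
  have : \forall y \near x, b j y - b j0 y < 0.
    by apply: (cvgr_lt _ (c x)); rewrite subr_lt0 bx.
  by apply: filterS => y; rewrite subr_lt0.
by [].
Qed.

(** * Minimizers of a maximum of affine functions *)

Lemma gpc_sublevel_max {I : finType} {a : I -> X -> R^o} {G : X -> R} {C}
    (c : R) : (forall i, cont_affine (a i)) -> is_max_on a G C ->
  gen_polyhedral_convex_set C ->
  gen_polyhedral_convex_set (C `&` [set x | G x <= c]).
Proof.
move=> ca aG gC.
have -> : C `&` [set x | G x <= c] = C `&` \bigcap_i [set x | a i x <= c].
  apply/seteqP; split=> x /= [Cx]; have [aleG [i0 ai0G]] := aG x Cx.
    by move=> Gc; split=> // i _ /=; exact: le_trans (aleG i) Gc.
  by move=> /(_ i0 Logic.I) /=; rewrite ai0G.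
by apply: gpc_setI => //; apply: gpc_bigcap => i; exact: gpc_sublevel.
Qed.

Definition argmin (G : X -> R) C : set X :=
  [set x | C x /\ forall y, C y -> G x <= G y].

(** When a minimizer exists, the minimizers are the sublevel set at the minimal
    value. *)
Lemma gpc_argmin_max {I : finType} {a : I -> X -> R^o} {G : X -> R} {C} :
  (forall i, cont_affine (a i)) -> is_max_on a G C ->
  gen_polyhedral_convex_set C -> gen_polyhedral_convex_set (argmin G C).
Proof.
move=> ca aG gC; have [[x0 [Cx0 minx0]]|empty] := pselect (argmin G C !=set0).
  have -> : argmin G C = C `&` [set x | G x <= G x0].
    apply/seteqP; split=> x [Cx]; first by move=> minx; split=> //; exact: minx.
    by move=> /= xx0; split=> // y Cy; exact: le_trans xx0 (minx0 y Cy).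
  exact: gpc_sublevel_max.
have -> : argmin G C = set0 by apply/seteqP; split=> x // ?; apply: empty; exists x.
exact: gpc_set0.
Qed.

(** Local minimizers of a convex function are global: along the segment from [x]
    to [y], a value below [G x] at [y] would propagate to points arbitrarily
    close to [x].  Convexity enters through the affine piece that attains the
    maximum at the chosen point of the segment. *)
Lemma local_argmin_max {I : finType} {a : I -> X -> R^o} {G : X -> R} {C U} x :
  (forall i, cont_affine (a i)) -> is_max_on a G C ->
  gen_polyhedral_convex_set C -> C x -> nbhs x U ->
  (forall y, (C `&` U) y -> G x <= G y) -> argmin G C x.
Proof.
move=> ca aG gC Cx xU minx; split=> // y Cy.
have [t /andP[t0 t1] Uz] := near_segment x y _ xU.
have Cz : C ((1 - t) *: x + t *: y).
  by apply: gpc_segment => //; rewrite ltW.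
have [_ [i aiG]] := aG _ Cz.
have := minx _ (conj Cz Uz); rewrite -aiG (ca i).2.
have := (aG x Cx).1 i; have := (aG y Cy).1 i.
nra.
Qed.

(** * Generalized polyhedral convex functions as maxima *)

(** On [X * R] a constraint reads [u k x + s * c k <= al k].  As the epigraph
    is stable under increasing [s], [c k <= 0].  The constraints with [c k = 0]
    only cut out the domain; those with [c k < 0] say that [s] is at least the
    affine function [(al k - u k x) / c k]. *)
Lemma gpc_fun_max (phi : X -> \bar R) : proper_fun phi ->
  gen_polyhedral_convex_fun phi ->
  exists (I : finType) (a : I -> X -> R^o),
    (forall i, cont_affine (a i)) /\
    is_max_on a (fun x => fine (phi x)) (dom phi).
Proof.
move=> [[x0 dx0] phi_gt] [L [p [z [al [affL _ cz epiE]]]]].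
have finE x : dom phi x -> phi x = (fine (phi x))%:E.
  by move=> dx; rewrite fineK// fin_numE gt_eqF//= lt_eqF.
have memE x s : dom phi x ->
    fine (phi x) <= s <-> L (x, s) /\ forall k, z k (x, s) <= al k.
  move=> dx; have -> : (L (x, s) /\ forall k, z k (x, s) <= al k) = epi phi (x, s).
    by rewrite epiE.
  by rewrite /epi/= [in X in _ <-> X](finE x dx) lee_fin; split=> [|[]].
pose u k (x : X) : R := z k (x, 0).
pose c k : R := z k (0, 1).
have zE k x s : z k (x, s) = u k x + s * c k.
  have -> : (x, s) = (x, 0) + s *: ((0, 1) : X * R^o).
    by rewrite -[RHS]/(x + s *: 0, 0 + s * 1) scaler0 addr0 add0r mulr1.
  by rewrite linearD linearZ.
(* The affine hull of two points of a vertical line is the whole line. *)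
have LE x s : dom phi x -> L (x, s).
  move=> dx.
  pose r := fine (phi x).
  have [Lr _] := (memE x r dx).1 (lexx _).
  have [Lr1 _] : L (x, r + 1) /\ forall k, z k (x, r + 1) <= al k
    by apply/(memE x _ dx); rewrite lerDl.
  have := affL _ _ (s - r) Lr Lr1.
  suff -> : (1 - (s - r)) *: ((x, r) : X * R^o) + (s - r) *: (x, r + 1) = (x, s) by [].
  rewrite -[LHS]/((1 - (s - r)) *: x + (s - r) *: x,
                  (1 - (s - r)) * r + (s - r) * (r + 1)).
  by rewrite -scalerDl subrK scale1r; congr pair; ring.
have c_le0 k : c k <= 0.
  rewrite leNgt; apply/negP => ck.
  pose r := fine (phi x0).
  (* a height in the epigraph above x0 at which the constraint k would fail *)
  pose s := Num.max r ((al k - u k x0) / c k + 1).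
  have [_ /(_ k)] : L (x0, s) /\ forall k, z k (x0, s) <= al k.
    by apply/(memE x0 _ dx0); rewrite le_max lexx.
  rewrite zE -lerBrDl -ler_pdivlMr// => /(le_trans _) - /(_ ((al k - u k x0) / c k + 1)).
  by rewrite le_max lexx orbT => /(_ isT); rewrite gerDl ler10.
pose I := {k : 'I_p | c k < 0}.
pose a (i : I) (x : X) : R^o := (al (val i) - u (val i) x) / c (val i).
have aP x s : dom phi x -> fine (phi x) <= s <-> forall i, a i x <= s.
  move=> dx; rewrite (memE x s dx).
  split=> [[_ zal] [k ck]|aes].
    by rewrite /a/= ler_ndivrMr// lerBrDl -zE.
  split=> [|k]; first exact: LE.
  have [ck|ck] := ltP (c k) 0.
    have := aes (exist _ k ck).
    by rewrite /a/= ler_ndivrMr// lerBrDl -zE.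
  have [_ /(_ k)] := (memE x _ dx).1 (lexx _).
  by rewrite !zE (_ : c k = 0) ?mulr0//; apply/eqP; rewrite eq_le c_le0.
exists I, a; split=> [i|x dx].
  split=> [x|x y t].
    have cu : continuous (u (val i) : X -> R^o).
      move=> w; apply: (@cvg_comp _ _ _ (fun w : X => (w, 0 : R^o)) (z (val i))
        _ (nbhs (w, 0 : R^o))); last exact: cz.
      by apply: (@cvg_pair _ _ _ _ (nbhs w) (nbhs (0 : R^o)));
        [exact: cvg_id|exact: cvg_cst].
    apply: (@cvgM _ X); last exact: cvg_cst.
    by apply: (@cvgB _ _ X); [exact: cvg_cst|exact: cu].
  have -> : a i ((1 - t) *: x + t *: y) =
      (al (val i) - ((1 - t) * u (val i) x + t * u (val i) y)) / c (val i).
    rewrite /a; congr ((_ - _) / _).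
    rewrite /u; set w := (_, 0).
    have -> : w = (1 - t) *: ((x, 0) : X * R^o) + t *: ((y, 0) : X * R^o).
      by rewrite -[RHS]/((1 - t) *: x + t *: y, (1 - t) * 0 + t * 0) !mulr0 addr0.
    by rewrite linearD !linearZ.
  by rewrite /a; ring.
have a_le := (aP x _ dx).1 (lexx (fine (phi x))).
split=> //.
(* Without any lower bound, the value at x would be minus infinity. *)
have [[i0 _]|noI] := pselect (exists i : I, True); last first.
  have : fine (phi x) <= fine (phi x) - 1.
    by apply/(aP x _ dx) => i; case: noI; exists i.
  by rewrite lerDl ler0N1.
pose i := [arg max_(j > i0) a j x]%O.
exists i; apply/le_anti; rewrite a_le /=; apply/(aP x _ dx) => j.
by rewrite /i; case: Order.TotalTheory.arg_maxP => // k _; exact.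
Qed.

(** * Minimizing a difference of two maxima of affine functions *)

Section DifferenceOfMaxima.
Context {I J : finType} {a : I -> X -> R^o} {b : J -> X -> R^o}.
Context {G H : X -> R} {f : X -> \bar R} {C : set X}.
Context (ca : forall i, cont_affine (a i)) (cb : forall j, cont_affine (b j)).
Context (aG : is_max_on a G C) (bH : is_max_on b H C).
Context (gC : gen_polyhedral_convex_set C).
Context (fE : forall x, C x -> f x = (G x - H x)%:E).

Let cab j i : cont_affine (fun x => a i x - b j x : R^o).
Proof. exact: cont_affineB. Qed.

Lemma global_solutions_diff_max :
  finite_union_of (@gen_polyhedral_convex_set R X) (global_solutions f C).
Proof.
have [[x0 [Cx0 minx0]]|empty] := pselect (global_solutions f C !=set0).
  have -> : global_solutions f C =
      \bigcup_j (C `&` [set x | G x - b j x <= G x0 - H x0]).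
    apply/seteqP; split=> x.
      move=> [Cx minx]; have [_ [j bjH]] := bH x Cx.
      exists j => //; split=> //=; rewrite bjH.
      by have := minx _ Cx0; rewrite !fE// lee_fin.
    move=> [j _ [Cx /= le_m]]; split=> // y Cy.
    apply: le_trans (minx0 y Cy); rewrite !fE// lee_fin.
    have := (bH x Cx).1 j; lra.
  apply: finite_union_of_fintype => j.
  exact: (gpc_sublevel_max _ (cab j) (is_max_onB _ aG) gC).
exists 0%N, (fun=> set0); split; first by case.
apply/seteqP; split=> x; first by move=> Sx; case: empty; exists x.
by case=> -[].
Qed.

(** The pieces of the local solution set: [P K] is the polyhedral part and
    [O K j0] the relatively open part, where no index outside [K] is active.
    [O K j0] is empty unless [j0] belongs to [K]. *)
Let P (K : {set J}) : set X :=
  C `&` \bigcap_j (if j \in K then argmin (fun x => G x - b j x) C else setT).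

Let O (K : {set J}) (j0 : J) : set X :=
  [set x | forall j, j \notin K -> b j x < b j0 x] `&` C.

(** A local solution [x] lies in the piece of its own active set [K] and any
    [j0] in [K].  Conversely, in the piece of [(K, j0)], the relatively open
    part is itself a neighbourhood in [C] on which [x] is minimal: at each of
    its points [y] an active [j] lies in [K], and [x] minimizes [G - b j]. *)
Lemma local_solutions_diff_max :
  finite_union_of (semiclosed_gen_polyhedral_convex_subset C)
    (local_solutions f C).
Proof.
have -> : local_solutions f C = \bigcup_(Kj in setT) (P Kj.1 `&` O Kj.1 Kj.2).
  apply/seteqP; split=> x.
    move=> [Cx [U xU minx]]; have [bleH [j0 bj0H]] := bH x Cx.
    exists ([set j | b j x == H x]%SET, j0) => //; split; split=> //=.
      move=> j _; rewrite inE; case: eqP => // bjH.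
      apply: (local_argmin_max x (cab j) (is_max_onB _ aG) gC Cx xU) => y [Cy Uy].
      have := minx y (conj Cy Uy); rewrite !fE// lee_fin bjH.
      have := (bH y Cy).1 j; lra.
    by move=> j; rewrite inE bj0H lt_neqAle bleH andbT.
  move=> [[K j0] _ /= [[Cx xP] [xO _]]]; split=> //.
  exists [set y | forall j, j \notin K -> b j y < b j0 y].
    by apply: open_nbhs_nbhs; split => //; exact: open_cont_affine_lt.
  move=> y [Cy yO]; rewrite !fE// lee_fin.
  have [bleHy [j bjHy]] := bH y Cy.
  have jK : j \in K.
    by apply/negPn/negP => /yO; rewrite bjHy ltNge bleHy.
  have := xP j Logic.I; rewrite jK => -[_ /(_ y Cy)]; rewrite bjHy.
  have := (bH x Cx).1 j; lra.
apply: finite_union_of_fintype => -[K j0] /=.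
exists (P K), (O K j0); split=> //.
- apply: gpc_setI => //; apply: gpc_bigcap => j.
  case: ifP => _; last exact: gpc_setT.
  exact: (gpc_argmin_max (cab j) (is_max_onB _ aG) gC).
- by move=> x [].
- split=> [x []//|]; move=> x y t; rewrite !inE => -[xO Cx] [yO Cy].
  have t01 : 0 <= 1 - (t%:num : R) <= 1 by rewrite subr_ge0 lerBlDl lerDr ge0 le1.
  have -> : conv t x y = (1 - (1 - t%:num)) *: (x : X) + (1 - t%:num) *: (y : X).
    by rewrite subKr.
  split; last exact: gpc_segment.
  move=> j jK; rewrite (cb j).2 (cb j0).2.
  have xlt := xO j jK; have ylt := yO j jK.
  move: (1 - t%:num) t01 => s /andP[s0 s1].
  have [->|sneq0] := eqVneq s 0; first by rewrite subr0 !mul0r !addr0 !mul1r.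
  apply: ler_ltD; first by rewrite ler_wpM2l ?subr_ge0// ltW.
  by rewrite ltr_pM2l// lt_neqAle eq_sym sneq0.
- apply/open_subspaceP; exists [set x | forall j, j \notin K -> b j x < b j0 x].
    exact: open_cont_affine_lt.
  by rewrite /O -setIA setIid.
Qed.

End DifferenceOfMaxima.

End GenPolyhedralConvexSets.

(** * The solution sets of the minimization problem *)

Theorem theorem4p2 (R : realType) (X : tvsType R) (hX : hausdorff_space X)
    (g h : X -> \bar R) (C : set X)
    (g_proper : proper_fun g) (g_gpc : gen_polyhedral_convex_fun g)
    (h_proper : proper_fun h) (h_gpc : gen_polyhedral_convex_fun h)
    (C_neq0 : C !=set0) (C_gpc : gen_polyhedral_convex_set C)
    (C_dom_g : C `<=` dom g)
    (C_int_dom_h : C `<=` interior (dom h)) :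
  let f : X -> \bar R := fun x => (g x - h x)%E in
  finite_union_of (semiclosed_gen_polyhedral_convex_subset C)
    (local_solutions f C) /\
  finite_union_of (@gen_polyhedral_convex_set R X)
    (global_solutions f C).
Proof.
move=> f.
have [I [a [ca aG]]] := gpc_fun_max g g_proper g_gpc.
have [J [b [cb bH]]] := gpc_fun_max h h_proper h_gpc.
have C_dom_h : C `<=` dom h := subset_trans C_int_dom_h (@interior_subset _ _).
have fE x : C x -> f x = (fine (g x) - fine (h x))%:E.
  move=> Cx; rewrite EFinB !fineK// fin_numE gt_eqF ?lt_eqF//.
  - exact: C_dom_h.
  - exact: h_proper.2.
  - exact: C_dom_g.
  - exact: g_proper.2.
have aGC := is_max_onS C_dom_g aG.
have bHC := is_max_onS C_dom_h bH.
split.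
- exact: (local_solutions_diff_max ca cb aGC bHC C_gpc fE).
- exact: (global_solutions_diff_max ca cb aGC bHC C_gpc fE).
Qed.
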